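(* Let $\kappa$ be an uncountable regular cardinal and let $k\in\mathbb N$. Then every $k$-connected graph with at least $\kappa$ vertices contains a subdivision of the complete bipartite graph $K_{k,\kappa}$. *)

(* Defs.v *)
From Stdlib Require Import List.
Import ListNotations.

Definition simple_graph {V : Type} (adj : V -> V -> Prop) : Prop :=
  (forall u v, adj u v -> adj v u) /\ (forall u, ~ adj u u).

Definition le_card (A B : Type) : Prop := exists f : A -> B, forall x y, f x = f y -> x = y.
Definition lt_card (A B : Type) : Prop := le_card A B /\ ~ le_card B A.

Definition uncountable (K : Type) : Prop := ~ le_card K nat.

Definition regular_card (K : Type) : Prop :=
  forall (I : Type) (S : I -> K -> Prop),
    lt_card I K ->
    (forall i, lt_card {x : K | S i x} K) ->
    exists x : K, forall i, ~ S i x.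

Inductive walk {V : Type} (adj : V -> V -> Prop) : V -> list V -> V -> Prop :=
| walk_nil : forall u, walk adj u [u] u
| walk_cons : forall u w l v, adj u w -> walk adj w l v -> walk adj u (u :: l) v.

Definition path {V : Type} (adj : V -> V -> Prop) (u : V) (p : list V) (v : V) : Prop :=
  walk adj u p v /\ NoDup p.

(* k-connected (Diestel): more than k vertices, and G - X is connected
   for every set X of fewer than k vertices. *)
Definition k_connected {V : Type} (adj : V -> V -> Prop) (k : nat) : Prop :=
  (exists l : list V, NoDup l /\ length l = S k) /\
  forall X : list V, length X < k ->
    forall u v, ~ In u X -> ~ In v X ->
      exists p, path adj u p v /\ forall w, In w p -> ~ In w X.

(* G contains a subdivision of K_{k,|K|}: branch vertices a 0..a (k-1) and
   b x (x : K), all distinct, and for each i < k and x : K a path P i x from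
   a i to b x whose inner vertices are not branch vertices, such that distinct
   paths share no inner vertices (i.e. they meet only in branch vertices). *)
Definition contains_subdivision_Kk {V K : Type} (adj : V -> V -> Prop) (k : nat) : Prop :=
  exists (a : nat -> V) (b : K -> V) (P : nat -> K -> list V),
    (forall i j, i < k -> j < k -> a i = a j -> i = j) /\
    (forall x y, b x = b y -> x = y) /\
    (forall i x, i < k -> a i <> b x) /\
    (forall i x, i < k -> path adj (a i) (P i x) (b x)) /\
    (forall i x w, i < k -> In w (P i x) -> w <> a i -> w <> b x ->
        (forall j, j < k -> w <> a j) /\ (forall y, w <> b y)) /\
    (forall i j x y w, i < k -> j < k -> (i <> j \/ x <> y) ->
        In w (P i x) -> In w (P j y) ->
        (exists l, l < k /\ w = a l) \/ (exists z, w = b z)).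

(* Main.v *)
(** For a [k]-set [l], take a maximal family of fans with [k] paths ending in [l] that are
    pairwise disjoint outside [l].  If one of these families has size [K], its members are the
    stars of a subdivided [K_{k,K}].  Otherwise start with any [k] vertices and add, in [omega]
    rounds, the vertices of the families of all [k]-sets obtained so far.  As [K] is regular and
    uncountable, the resulting set [U] has fewer than [K] elements, so there is a vertex [v]
    outside [U].  By Menger's theorem some fan joins [v] to a [k]-set [l] in [U] and meets [U]
    only in [l]; as [l] lies in one of the rounds, this fan could be added to the family of [l],
    contradicting maximality.

    Menger's theorem is proved for finite edge sets by deleting an edge, and transferred to
    infinite graphs by a compactness argument. *)

From Stdlib Require Import List Lia Arith Classical IndefiniteDescription.
From mathcomp Require boolp classical_sets.
Require Import Defs.
Import ListNotations.

(** * Walks *)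

Lemma walk_source {V} (adj : V -> V -> Prop) u p v : walk adj u p v -> In u p.
Proof. intros H; inversion H; simpl; auto. Qed.

Lemma walk_target {V} (adj : V -> V -> Prop) u p v : walk adj u p v -> In v p.
Proof. induction 1; simpl; auto. Qed.

Lemma walk_app {V} (adj : V -> V -> Prop) u p w z q v :
  walk adj u p w -> adj w z -> walk adj z q v -> walk adj u (p ++ q) v.
Proof.
  induction 1; simpl; intros.
  - now apply walk_cons with z.
  - apply walk_cons with w; auto.
Qed.

Lemma walk_join {V} (adj : V -> V -> Prop) u p w q v :
  walk adj u (p ++ [w]) w -> walk adj w (w :: q) v -> walk adj u (p ++ w :: q) v.
Proof.
  revert u; induction p as [|a p IH]; simpl; intros u H1 H2.
  - inversion H1; subst; auto.
  - inversion H1; subst.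
    + destruct p; discriminate.
    + apply walk_cons with w0; auto.
Qed.

Lemma walk_rev {V} (adj : V -> V -> Prop) u p v :
  (forall a b, adj a b -> adj b a) -> walk adj u p v -> walk adj v (rev p) u.
Proof.
  intros Hs; induction 1; simpl.
  - constructor.
  - apply walk_app with w u; auto. constructor.
Qed.

Lemma walk_mono {V} (adj adj' : V -> V -> Prop) u p v :
  (forall a b, adj a b -> adj' a b) -> walk adj u p v -> walk adj' u p v.
Proof. intros Hs; induction 1; econstructor; eauto. Qed.

Lemma walk_split {V} (adj : V -> V -> Prop) u p v w :
  walk adj u p v -> In w p ->
  exists p1 p2, p = p1 ++ w :: p2 /\ walk adj u (p1 ++ [w]) w /\ walk adj w (w :: p2) v.
Proof.
  induction 1 as [u|u z l v Hadj Hw IH]; simpl; intros Hin.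
  - destruct Hin as [->|[]]. exists [], []; repeat split; constructor.
  - destruct Hin as [->|Hin].
    + exists [], l; repeat split; try constructor. now apply walk_cons with z.
    + destruct (IH Hin) as (p1 & p2 & -> & H1 & H2).
      exists (u :: p1), p2; repeat split; auto. simpl; now apply walk_cons with z.
Qed.

Lemma walk_first_hit {V} (adj : V -> V -> Prop) (B : V -> Prop) u p v :
  walk adj u p v -> B v ->
  exists q w, B w /\ walk adj u (q ++ [w]) w /\ (forall z, In z q -> ~ B z) /\
    incl (q ++ [w]) p.
Proof.
  induction 1 as [u|u z l v Hadj Hw IH]; intros HB.
  - exists [], u; split; [|split; [|split]]; auto; [constructor|apply incl_refl].
  - destruct (classic (B u)) as [Hu|Hu].
    + exists [], u; split; [|split; [|split]]; auto; [constructor|].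
      intros a [<-|[]]; simpl; auto.
    + destruct (IH HB) as (q & w & Hw1 & Hw2 & Hw3 & Hw4).
      exists (u :: q), w; repeat split; auto.
      * simpl; now apply walk_cons with z.
      * intros a [<-|Ha]; auto.
      * intros a [<-|Ha]; simpl; auto.
Qed.

Lemma walk_to_path {V} (adj : V -> V -> Prop) u p v :
  walk adj u p v -> exists q, path adj u q v /\ incl q p.
Proof.
  induction 1 as [u|u z l v Hadj Hw IH].
  - exists [u]; split; [split; [constructor|]|apply incl_refl].
    constructor; [simpl; tauto|constructor].
  - destruct IH as (q & [Hq Hnd] & Hi).
    destruct (classic (In u q)) as [Hu|Hu].
    + destruct (walk_split _ _ _ _ _ Hq Hu) as (p1 & p2 & -> & _ & H2).
      exists (u :: p2); split; [split; auto|].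
      * now apply NoDup_app_remove_l in Hnd.
      * intros a Ha; right; apply Hi, in_or_app; auto.
    + exists (u :: q); split; [split|].
      * now apply walk_cons with z.
      * now constructor.
      * intros a [<-|Ha]; simpl; auto.
Qed.

(** * Menger's theorem *)

(** [X] may contain vertices of [A] and [B]; as a list may repeat entries, its length only bounds
    the size of the separator from above. *)
Definition separates {V} (adj : V -> V -> Prop) (A B : V -> Prop) (X : list V) : Prop :=
  forall u p v, A u -> B v -> walk adj u p v -> exists z, In z p /\ In z X.

(** Only disjointness is at stake here, so walks suffice; they are shortened to paths when fans are
    built. *)
Definition linked {V} (adj : V -> V -> Prop) (A B : V -> Prop) (k : nat) : Prop :=
  exists P : nat -> list V,
    (forall i, i < k -> exists u v, A u /\ B v /\ walk adj u (P i) v) /\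
    (forall i j, i < k -> j < k -> i <> j -> forall w, In w (P i) -> ~ In w (P j)).

Lemma linked_mono {V} (adj adj' : V -> V -> Prop) A B k :
  (forall a b, adj a b -> adj' a b) -> linked adj A B k -> linked adj' A B k.
Proof.
  intros Hs (P & H1 & H2); exists P; split; auto.
  intros i Hi; destruct (H1 i Hi) as (u & v & Hu & Hv & Hw).
  exists u, v; repeat split; auto. eapply walk_mono; eauto.
Qed.

Lemma separates_mono {V} (adj adj' : V -> V -> Prop) A B X :
  (forall a b, adj a b -> adj' a b) -> separates adj' A B X -> separates adj A B X.
Proof. intros Hs H u p v Hu Hv Hw; eapply H; eauto. eapply walk_mono; eauto. Qed.

Lemma separates_sym {V} (adj : V -> V -> Prop) A B X :
  (forall a b, adj a b -> adj b a) -> separates adj A B X -> separates adj B A X.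
Proof.
  intros Hs H u p v Hu Hv Hw.
  destruct (H v (rev p) u Hv Hu) as (z & Hz & Hx).
  - now apply walk_rev.
  - exists z; split; auto. now apply in_rev.
Qed.

Lemma choice_below {T} (R : nat -> T -> Prop) (d : T) k :
  (forall i, i < k -> exists t, R i t) -> exists f, forall i, i < k -> R i (f i).
Proof.
  intros H; apply (functional_choice (fun i t => i < k -> R i t)).
  intros i; destruct (classic (i < k)) as [Hi|Hi].
  - destruct (H i Hi) as [t Ht]; exists t; auto.
  - exists d; tauto.
Qed.

Lemma NoDup_map_seq {T} (f : nat -> T) k :
  (forall i j, i < k -> j < k -> f i = f j -> i = j) -> NoDup (map f (seq 0 k)).
Proof.
  intros H; apply NoDup_map_NoDup_ForallPairs; [|apply seq_NoDup].
  intros i j Hi Hj; apply in_seq in Hi, Hj; apply H; lia.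
Qed.

(** Pigeonhole: [k] distinct values leave no room for repetitions or further entries. *)
Lemma distinct_values_exhaust {T} (f : nat -> T) k X :
  (forall i j, i < k -> j < k -> f i = f j -> i = j) ->
  (forall i, i < k -> In (f i) X) -> length X <= k ->
  NoDup X /\ forall s, In s X -> exists i, i < k /\ f i = s.
Proof.
  intros Hinj Hin Hlen.
  pose proof (NoDup_map_seq f k Hinj) as Hnd.
  assert (Hincl : incl (map f (seq 0 k)) X).
  { intros s Hs; apply in_map_iff in Hs; destruct Hs as (i & <- & Hi).
    apply in_seq in Hi; apply Hin; lia. }
  assert (Hl : length X <= length (map f (seq 0 k))) by now rewrite length_map, length_seq.
  split.
  - eapply NoDup_incl_NoDup; eauto.
  - intros s Hs; apply (NoDup_length_incl Hnd Hl Hincl), in_map_iff in Hs.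
    destruct Hs as (i & <- & Hi); apply in_seq in Hi; exists i; split; auto; lia.
Qed.

(** Each walk is cut at its first vertex in [B] and stored as the part before the hit together with
    the hit. The pieces stay inside the given walks, so they remain disjoint. *)
Lemma linked_first_hit {V} (adj : V -> V -> Prop) A B k (d : V) :
  linked adj A B k ->
  exists f : nat -> list V * V,
    (forall i, i < k -> B (snd (f i)) /\
       (exists u, A u /\ walk adj u (fst (f i) ++ [snd (f i)]) (snd (f i))) /\
       (forall z, In z (fst (f i)) -> ~ B z)) /\
    (forall i j w, i < k -> j < k -> In w (fst (f i) ++ [snd (f i)]) ->
       In w (fst (f j) ++ [snd (f j)]) -> i = j).
Proof.
  intros (P & H1 & H2).
  destruct (choice_below (fun i (q : list V * V) => B (snd q) /\
       (exists u, A u /\ walk adj u (fst q ++ [snd q]) (snd q)) /\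
       (forall z, In z (fst q) -> ~ B z) /\ incl (fst q ++ [snd q]) (P i)) ([], d) k)
    as [f Hf].
  { intros i Hi; destruct (H1 i Hi) as (a & b & Ha & Hb & Hw).
    destruct (walk_first_hit _ B _ _ _ Hw Hb) as (q & w & Hq1 & Hq2 & Hq3 & Hq4).
    exists (q, w); simpl; repeat split; auto. exists a; auto. }
  exists f; split.
  - intros i Hi; destruct (Hf i Hi) as (? & ? & ? & ?); auto.
  - intros i j w Hi Hj Hwi Hwj.
    destruct (classic (i = j)) as [|Hne]; auto.
    exfalso; apply (H2 i j Hi Hj Hne w); [apply (Hf i Hi)|apply (Hf j Hj)]; auto.
Qed.

(* The hypothesis on [eq y] orients the edge [xy]: [x] lies on the side of [A], [y] on that
   of [B]. *)
Lemma separates_delete_edge {V} (adj' adj : V -> V -> Prop) (x y : V) S A B Z :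
  (forall u w, adj u w -> adj' u w \/ (u = x /\ w = y) \/ (u = y /\ w = x)) ->
  separates adj' A B S -> separates adj' A (eq y) S ->
  separates adj' A (fun z => In z (x :: S)) Z -> separates adj A B Z.
Proof.
  intros Hadj HS Hy HZ u p v Hu Hv Hw.
  apply NNPP; intros Hno.
  (* Invariant: [u] is reached from [A] in [adj'] by a walk avoiding [Z] and [x :: S]. Entering
     [x :: S] would contradict [HZ], standing at [y] would contradict [Hy], and ending in [B] would
     contradict [HS]. *)
  assert (Hgo : forall u p v, walk adj u p v -> B v -> (forall z, In z p -> ~ In z Z) ->
    (exists a q, A a /\ walk adj' a q u /\ (forall z, In z q -> ~ In z (x :: S)) /\
      (forall z, In z q -> ~ In z Z)) -> False).
  { clear u p v Hu Hv Hw Hno.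
    induction 1 as [u|u w l v Huw Hw IH]; intros Hv Hp (a & q & Ha & Hq & HqS & HqZ).
    - destruct (HS a q u Ha Hv Hq) as (z & Hz & HzS). apply (HqS z Hz); simpl; auto.
    - destruct (Hadj u w Huw) as [Huw'|[[-> ->]|[-> ->]]].
      + assert (Hq' : walk adj' a (q ++ [w]) w)
          by (eapply walk_app; eauto; constructor).
        assert (Hwl : In w l) by (eapply walk_source; eauto).
        assert (HZ' : forall z, In z (q ++ [w]) -> ~ In z Z).
        { intros z Hz; apply in_app_or in Hz; destruct Hz as [Hz|[<-|[]]]; auto.
          apply Hp; simpl; auto. }
        destruct (classic (In w (x :: S))) as [HwS|HwS].
        * destruct (HZ a (q ++ [w]) w Ha HwS Hq') as (z & Hz & HzZ).
          apply (HZ' z Hz HzZ).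
        * apply IH; auto.
          -- intros z Hz; apply Hp; simpl; auto.
          -- exists a, (q ++ [w]); repeat split; auto.
             intros z Hz; apply in_app_or in Hz; destruct Hz as [Hz|[<-|[]]]; auto.
      + apply (HqS x); simpl; auto. eapply walk_target; eauto.
      + destruct (Hy a q y Ha eq_refl Hq) as (z & Hz & HzS).
        apply (HqS z Hz); simpl; auto. }
  apply (Hgo u p v Hw Hv).
  - intros z Hz HzZ; apply Hno; eauto.
  - assert (Hup : In u p) by (eapply walk_source; eauto).
    destruct (classic (In u (x :: S))) as [HuS|HuS].
    + exfalso. destruct (HZ u [u] u Hu HuS) as (z & [<-|[]] & HzZ); [constructor|].
      apply Hno; eauto.
    + exists u, [u]; repeat split; auto; try constructor.
      * intros z [<-|[]]; auto.
      * intros z [<-|[]] HzZ; apply Hno; eauto.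
Qed.

(** For a walk cut at its first hit [s]: whatever precedes a vertex [w] of it lies before the hit,
    hence outside the target set. *)
Lemma prefix_before_hit {T} (p1 p2 l : list T) w s :
  p1 ++ w :: p2 = l ++ [s] -> incl p1 l.
Proof.
  intros H; destruct (@exists_last _ (w :: p2)) as (q & t & Hq); [discriminate|].
  rewrite Hq, app_assoc in H; apply app_inj_tail in H as [<- _].
  apply incl_appl, incl_refl.
Qed.

(** An [A]-walk ending in [S] is continued backwards along the [B]-walk with the same end; an
    [A]-walk ending in [x] crosses the new edge to the [B]-walk ending in [y]. *)
Lemma linked_add_edge {V} (adj' adj : V -> V -> Prop) (x y : V) S A B k :
  (forall u w, adj' u w -> adj' w u) ->
  (forall u w, adj u w <-> adj' u w \/ (u = x /\ w = y) \/ (u = y /\ w = x)) ->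
  separates adj' A B S -> length S < k ->
  linked adj' A (fun z => In z (x :: S)) k ->
  linked adj' B (fun z => In z (y :: S)) k ->
  linked adj A B k.
Proof.
  intros Hsym Hadj HS Hlen HA HB.
  destruct (linked_first_hit _ _ _ _ x HA) as (f & Hf & Hfd).
  destruct (linked_first_hit _ _ _ _ x HB) as (g & Hg & Hgd).
  assert (Hend : forall h : nat -> list V * V, forall i, In (snd (h i)) (fst (h i) ++ [snd (h i)]))
    by (intros; apply in_or_app; simpl; auto).
  assert (Hfi : forall i j, i < k -> j < k -> snd (f i) = snd (f j) -> i = j).
  { intros i j Hi Hj Heq; apply (Hfd i j (snd (f i)) Hi Hj); auto. rewrite Heq; auto. }
  assert (Hgi : forall i j, i < k -> j < k -> snd (g i) = snd (g j) -> i = j).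
  { intros i j Hi Hj Heq; apply (Hgd i j (snd (g i)) Hi Hj); auto. rewrite Heq; auto. }
  (* As [y :: S] has at most [k] entries, the ends of the [B]-walks exhaust it: every [A]-walk finds
     a partner, and [y] is not in [S]. *)
  destruct (distinct_values_exhaust (fun i => snd (g i)) k (y :: S)) as [Hnd Hsurj]; auto.
  { intros i Hi; apply (Hg i Hi). }
  assert (HyS : ~ In y S) by (inversion Hnd; auto).
  (* An [A]-walk and a [B]-walk only meet in [S], as following one up to the meeting
     point and the other from there on gives a walk from [A] to [B]. *)
  assert (Hmeet : forall i j w, i < k -> j < k -> In w (fst (f i) ++ [snd (f i)]) ->
    In w (fst (g j) ++ [snd (g j)]) -> In w S /\ w = snd (f i) /\ w = snd (g j)).
  { intros i j w Hi Hj Hwi Hwj.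
    destruct (Hf i Hi) as (_ & (a & Ha & Hwa) & Hfa).
    destruct (Hg j Hj) as (_ & (b & Hb & Hwb) & Hgb).
    destruct (walk_split _ _ _ _ _ Hwa Hwi) as (p1 & p2 & Hp & Hp1 & _).
    destruct (walk_split _ _ _ _ _ Hwb Hwj) as (q1 & q2 & Hq & Hq1 & _).
    symmetry in Hp, Hq; apply prefix_before_hit in Hp, Hq.
    assert (HwS : In w S).
    { apply walk_rev in Hq1; auto. rewrite rev_app_distr in Hq1; simpl in Hq1.
      pose proof (walk_join _ _ _ _ _ _ Hp1 Hq1) as Hj'.
      destruct (HS _ _ _ Ha Hb Hj') as (z & Hz & HzS).
      apply in_app_or in Hz; destruct Hz as [Hz|[<-|Hz]]; auto; exfalso.
      - apply (Hfa z (Hp z Hz)); simpl; auto.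
      - apply in_rev in Hz. apply (Hgb z (Hq z Hz)); simpl; auto. }
    split; auto; split.
    - apply in_app_or in Hwi; destruct Hwi as [Hwi|[<-|[]]]; auto.
      exfalso; apply (Hfa w Hwi); simpl; auto.
    - apply in_app_or in Hwj; destruct Hwj as [Hwj|[<-|[]]]; auto.
      exfalso; apply (Hgb w Hwj); simpl; auto. }
  destruct (choice_below (fun i r => (exists a b, A a /\ B b /\ walk adj a r b) /\
     exists j, j < k /\
       ((snd (f i) = x /\ snd (g j) = y) \/ (In (snd (g j)) S /\ snd (f i) = snd (g j))) /\
       forall w, In w r -> In w (fst (f i) ++ [snd (f i)]) \/ In w (fst (g j) ++ [snd (g j)]))
    [] k) as [R HR].
  { intros i Hi.
    destruct (Hf i Hi) as (Hs & (a & Ha & Hwa) & _).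
    assert (Hwa' : walk adj a (fst (f i) ++ [snd (f i)]) (snd (f i))).
    { eapply walk_mono; [|eauto]. intros; apply Hadj; auto. }
    assert (Hg' : forall j, j < k -> exists b, B b /\
       walk adj (snd (g j)) (snd (g j) :: rev (fst (g j))) b).
    { intros j Hj; destruct (Hg j Hj) as (_ & (b & Hb & Hwb) & _).
      exists b; split; auto.
      apply walk_rev in Hwb; auto. rewrite rev_app_distr in Hwb; simpl in Hwb.
      eapply walk_mono; [|eauto]. intros; apply Hadj; auto. }
    destruct Hs as [Hx|HsS].
    - destruct (Hsurj y) as (j & Hj & Hjy); [simpl; auto|].
      destruct (Hg' j Hj) as (b & Hb & Hwb).
      exists ((fst (f i) ++ [snd (f i)]) ++ (snd (g j) :: rev (fst (g j)))); split.
      + exists a, b; repeat split; auto.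
        eapply walk_app; eauto. apply Hadj; auto.
      + exists j; repeat split; auto.
        intros w Hw; apply in_app_or in Hw; destruct Hw as [Hw|Hw]; auto.
        right; apply in_or_app; destruct Hw as [<-|Hw]; simpl; auto.
        apply in_rev in Hw; auto.
    - destruct (Hsurj (snd (f i))) as (j & Hj & Hjy); [simpl; auto|].
      destruct (Hg' j Hj) as (b & Hb & Hwb).
      exists (fst (f i) ++ (snd (g j) :: rev (fst (g j)))); split.
      + exists a, b; repeat split; auto.
        apply walk_join; auto. rewrite Hjy; auto.
      + exists j; repeat split; auto.
        * right; split; auto. rewrite Hjy; auto.
        * intros w Hw; apply in_app_or in Hw; destruct Hw as [Hw|Hw].
          -- left; apply in_or_app; auto.
          -- right; apply in_or_app; destruct Hw as [<-|Hw]; simpl; auto.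
             apply in_rev in Hw; auto. }
  exists R; split; [intros i Hi; apply (HR i Hi)|].
  intros i i' Hi Hi' Hne w Hw Hw'.
  destruct (HR i Hi) as (_ & j & Hj & Hc & Hin).
  destruct (HR i' Hi') as (_ & j' & Hj' & Hc' & Hin').
  (* The meeting point is in [S] and is the end of both pieces. The [A]-walk glued to this [B]-walk
     also ends there, because [y] is not in [S]; so it is the given one. *)
  assert (Hcross : forall i i' j', i < k -> i' < k -> j' < k ->
    (snd (f i') = x /\ snd (g j') = y \/ In (snd (g j')) S /\ snd (f i') = snd (g j')) ->
    In w (fst (f i) ++ [snd (f i)]) -> In w (fst (g j') ++ [snd (g j')]) -> i = i').
  { clear - Hmeet HyS Hfi. intros i i' j' Hi Hi' Hj' Hc' H1 H2.
    destruct (Hmeet i j' w Hi Hj' H1 H2) as (HwS & E1 & E2).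
    destruct Hc' as [[_ E]|[_ E]].
    - exfalso; apply HyS; congruence.
    - apply Hfi; auto; congruence. }
  destruct (Hin w Hw) as [H1|H1], (Hin' w Hw') as [H2|H2].
  - apply Hne, (Hfd i i' w); auto.
  - apply Hne, (Hcross i i' j'); auto.
  - apply Hne; symmetry; apply (Hcross i' i j); auto.
  - assert (j = j') by (apply (Hgd j j' w); auto). subst j'.
    destruct Hc as [[E1 E2]|[E1 E2]], Hc' as [[E3 E4]|[E3 E4]].
    + apply Hne, Hfi; auto; congruence.
    + apply HyS; congruence.
    + apply HyS; congruence.
    + apply Hne, Hfi; auto; congruence.
Qed.

Definition adj_of {V} (E : list (V * V)) (u w : V) : Prop := In (u, w) E \/ In (w, u) E.

Lemma adj_of_sym {V} (E : list (V * V)) u w : adj_of E u w -> adj_of E w u.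
Proof. unfold adj_of; tauto. Qed.

(** Elements are collected greedily; a list that cannot be extended covers [P]. *)
Lemma distinct_or_covered {T} (P : T -> Prop) k :
  (exists l, NoDup l /\ length l = k /\ forall z, In z l -> P z) \/
  (exists X, length X < k /\ forall z, P z -> In z X).
Proof.
  induction k as [|k [(l & Hl & Hk & HP)|(X & HX & HP)]].
  - left; exists []; repeat split; [constructor|]. simpl; tauto.
  - destruct (classic (exists z, P z /\ ~ In z l)) as [(z & Hz & Hzl)|Hn].
    + left; exists (z :: l); repeat split; [now constructor|simpl; lia|].
      intros a [<-|Ha]; auto.
    + right; exists l; split; [lia|].
      intros z Hz; apply NNPP; intros Hzl; apply Hn; eauto.
  - right; exists X; split; auto; lia.
Qed.

Lemma linked_common {V} (adj : V -> V -> Prop) A B k l :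
  NoDup l -> length l = k -> (forall z, In z l -> A z /\ B z) -> linked adj A B k.
Proof.
  intros Hnd Hlen Hl.
  exists (fun i => match nth_error l i with Some z => [z] | None => [] end); split.
  - intros i Hi. destruct (nth_error l i) as [z|] eqn:E.
    + apply nth_error_In in E; apply Hl in E.
      exists z, z; repeat split; try tauto. constructor.
    + apply nth_error_None in E; lia.
  - intros i j Hi Hj Hne w Hwi Hwj.
    destruct (nth_error l i) as [z|] eqn:E; [|destruct Hwi].
    destruct (nth_error l j) as [z'|] eqn:E'; [|destruct Hwj].
    destruct Hwi as [<-|[]], Hwj as [->|[]].
    apply Hne. apply (proj1 (NoDup_nth_error l) Hnd); [lia|congruence].
Qed.

(** Follow the walk to its first step from a vertex [u], reachable from [A] in [adj'] outside [S],
    to an unreachable [w]. This step must be the edge [xy]. Nor can [B] reach [u] outside [S], as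
    the two walks would join to one from [A] to [B]. *)
Lemma edge_orientation {V} (adj' adj : V -> V -> Prop) (x y : V) S A B u p v :
  (forall u w, adj' u w -> adj' w u) ->
  (forall u w, adj u w -> adj' u w \/ (u = x /\ w = y) \/ (u = y /\ w = x)) ->
  separates adj' A B S -> walk adj u p v -> B v -> (forall z, In z p -> ~ In z S) ->
  (exists a q, A a /\ walk adj' a q u /\ forall z, In z q -> ~ In z S) ->
  (separates adj' A (eq y) S /\ separates adj' B (eq x) S) \/
  (separates adj' A (eq x) S /\ separates adj' B (eq y) S).
Proof.
  intros Hsym Hadj HS.
  induction 1 as [u|u w l v Huw Hw IH]; intros Hv Hp (a & q & Ha & Hq & HqS).
  - exfalso. destruct (HS a q u Ha Hv Hq) as (z & Hz & HzS). apply (HqS z Hz HzS).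
  - assert (Hp' : forall z, In z l -> ~ In z S) by (intros z Hz; apply Hp; simpl; auto).
    destruct (classic (exists a q, A a /\ walk adj' a q w /\ forall z, In z q -> ~ In z S))
      as [Hr|Hr]; [now apply IH|].
    assert (HA : separates adj' A (eq w) S).
    { intros a' q' t Ha' <- Hq'. apply NNPP; intros Hn; apply Hr.
      exists a', q'; repeat split; auto. intros z Hz HzS; apply Hn; eauto. }
    assert (HB : separates adj' B (eq u) S).
    { intros b q' t Hb <- Hq'. apply NNPP; intros Hn.
      destruct q' as [|c q']; [inversion Hq'|].
      apply walk_rev in Hq'; auto.
      destruct (walk_split _ _ _ _ u Hq) as (q1 & q2 & -> & Hq1 & _);
        [eapply walk_target; eauto|].
      destruct (walk_split _ _ _ _ u Hq') as (r1 & r2 & Hr' & _ & Hr2);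
        [eapply walk_source; eauto|].
      destruct (HS a (q1 ++ u :: r2) b Ha Hb) as (z & Hz & HzS).
      { now apply walk_join. }
      apply in_app_or in Hz; destruct Hz as [Hz|Hz].
      - apply (HqS z); auto; apply in_or_app; auto.
      - apply Hn; exists z; split; auto. apply in_rev. rewrite Hr'.
        apply in_or_app; auto. }
    destruct (Hadj u w Huw) as [Huw'|[[-> ->]|[-> ->]]]; auto.
    exfalso; apply Hr; exists a, (q ++ [w]); repeat split; auto.
    + eapply walk_app; eauto; constructor.
    + intros z Hz; apply in_app_or in Hz; destruct Hz as [Hz|[<-|[]]]; auto.
      apply Hp'. eapply walk_source; eauto.
Qed.

(** If dropping [xy] creates a separator [S] of length less than [k], with [x] on the side of [A],
    then a set separating [A] from [x :: S] or [B] from [y :: S] without [xy] separates [A] from [B]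
    in the full graph. So induction supplies two linkages to be glued. *)
Theorem menger_finite {V} (E : list (V * V)) (A B : V -> Prop) k :
  (forall X, separates (adj_of E) A B X -> k <= length X) -> linked (adj_of E) A B k.
Proof.
  revert A B; induction E as [|[x y] E IH]; intros A B Hsep.
  (* Without edges, a walk from [A] to [B] is a single common vertex, so a cover of the intersection
     separates. *)
  - destruct (distinct_or_covered (fun z => A z /\ B z) k) as [(l & Hl & Hk & HP)|(X & HX & HP)].
    + eapply linked_common; eauto.
    + exfalso. enough (k <= length X) by lia. apply Hsep.
      intros u p v Hu Hv Hw. inversion Hw as [|? ? ? ? [[]|[]]]; subst.
      exists v; split; simpl; auto.
  - destruct (classic (exists S, separates (adj_of E) A B S /\ length S < k))
      as [(S & HS & Hlen)|Hn].
    2: { apply linked_mono with (adj_of E).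
         - unfold adj_of; simpl; tauto.
         - apply IH; intros X HX; apply NNPP; intros Hlt; apply Hn.
           exists X; split; auto; lia. }
    assert (Hadj : forall u w, adj_of ((x, y) :: E) u w <->
      adj_of E u w \/ (u = x /\ w = y) \/ (u = y /\ w = x)).
    { intros u w; unfold adj_of; simpl; split.
      - intros [[H|H]|[H|H]]; try injection H as -> ->; auto.
      - intros [[H|H]|[[-> ->]|[-> ->]]]; auto. }
    (* [S] is too small to separate in the full graph; a walk avoiding it must use [xy] and reveals
       which end lies on which side. *)
    assert (Hw : exists u p v, A u /\ B v /\ walk (adj_of ((x, y) :: E)) u p v /\
       forall z, In z p -> ~ In z S).
    { apply NNPP; intros Hc. enough (k <= length S) by lia. apply Hsep.
      intros u p v Hu Hv Hw. apply NNPP; intros Hz; apply Hc.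
      exists u, p, v; repeat split; auto. intros z Hz1 Hz2; apply Hz; eauto. }
    destruct Hw as (u & p & v & Hu & Hv & Hw & Hp).
    pose proof (fun a b => adj_of_sym (V := V) E a b) as Hsym.
    assert (Hstep : forall s t,
      (forall u w, adj_of ((x, y) :: E) u w <->
        adj_of E u w \/ (u = s /\ w = t) \/ (u = t /\ w = s)) ->
      separates (adj_of E) A (eq t) S -> separates (adj_of E) B (eq s) S ->
      linked (adj_of ((x, y) :: E)) A B k).
    { intros s t Hst HA HB.
      apply (linked_add_edge (adj_of E) _ s t S); auto.
      - apply IH; intros Z HZ; apply Hsep.
        apply (separates_delete_edge (adj_of E) _ s t S); auto. intros; now apply Hst.
      - apply IH; intros Z HZ; apply Hsep.
        apply separates_sym; [apply adj_of_sym|].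
        apply (separates_delete_edge (adj_of E) _ t s S); auto.
        + intros u' w' H'; apply Hst in H'; tauto.
        + now apply separates_sym. }
    destruct (edge_orientation (adj_of E) (adj_of ((x, y) :: E)) x y S A B u p v)
      as [[H1 H2]|[H1 H2]]; auto.
    + intros; now apply Hadj.
    + exists u, [u]; repeat split; auto; [constructor|].
      intros z [<-|[]]; apply Hp. eapply walk_source; eauto.
    + apply (Hstep x y); auto.
    + apply (Hstep y x); auto. intros u' w'; rewrite Hadj; tauto.
Qed.

(** * From finite edge sets to infinite graphs *)

Lemma walk_finite_edges {V} (adj : V -> V -> Prop) u p v :
  walk adj u p v ->
  exists E, (forall a b, In (a, b) E -> adj a b) /\ walk (adj_of E) u p v.
Proof.
  induction 1 as [u|u w l v Huw Hw (E & HE & Hl)].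
  - exists []; split; [simpl; tauto|constructor].
  - exists ((u, w) :: E); split.
    + intros a b [[= <- <-]|H]; auto.
    + apply walk_cons with w; [left; simpl; auto|].
      eapply walk_mono; [|eauto]. unfold adj_of; simpl; tauto.
Qed.

Lemma lists_over_finite {T} (L : list T) n :
  exists LL, forall X, length X = n -> incl X L -> In X LL.
Proof.
  induction n as [|n [LL IH]].
  - exists [[]]; intros [|]; simpl; auto; discriminate.
  - exists (flat_map (fun a => map (cons a) LL) L).
    intros [|a X] Hlen Hincl; [discriminate|].
    apply in_flat_map; exists a; split; [apply Hincl; simpl; auto|].
    apply in_map, IH; [simpl in Hlen; lia|].
    intros b Hb; apply Hincl; simpl; auto.
Qed.

(** One walk avoiding [X] shows that [X] does not separate, and it has finitely many edges; further
    edges do not destroy it. *)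
Lemma finite_edges_nonseparated {V} (adj : V -> V -> Prop) A B (LL : list (list V)) :
  (forall X, In X LL -> ~ separates adj A B X) ->
  exists E, (forall a b, In (a, b) E -> adj a b) /\
    forall X, In X LL -> ~ separates (adj_of E) A B X.
Proof.
  induction LL as [|X LL IH]; intros H.
  - exists []; simpl; tauto.
  - destruct IH as (E & HE & HLL); [intros; apply H; simpl; auto|].
    assert (HX : exists u p v, A u /\ B v /\ walk adj u p v /\ forall z, In z p -> ~ In z X).
    { apply NNPP; intros Hc; apply (H X); [simpl; auto|].
      intros u p v Hu Hv Hw; apply NNPP; intros Hz; apply Hc.
      exists u, p, v; repeat split; auto. intros z Hz1 Hz2; apply Hz; eauto. }
    destruct HX as (u & p & v & Hu & Hv & Hw & Hp).
    destruct (walk_finite_edges _ _ _ _ Hw) as (E' & HE' & Hw').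
    exists (E' ++ E); split.
    + intros a b Hab; apply in_app_or in Hab; destruct Hab; auto.
    + intros Y [<-|HY] Hs.
      * destruct (Hs u p v Hu Hv) as (z & Hz & HzX); [|apply (Hp z Hz HzX)].
        eapply walk_mono; [|eauto]. unfold adj_of; intros; rewrite !in_app_iff; tauto.
      * apply (HLL Y HY). eapply separates_mono; [|eauto].
        unfold adj_of; intros; rewrite !in_app_iff; tauto.
Qed.

(* A separator of size [j] has to pick one vertex from each of [j] disjoint paths, so only
   finitely many candidates must be avoided to pass from [j] to [j + 1]. *)
Lemma finite_edges_same_connectivity {V} (adj : V -> V -> Prop) A B k :
  (forall X, separates adj A B X -> k <= length X) ->
  exists E, (forall a b, In (a, b) E -> adj a b) /\
    forall X, separates (adj_of E) A B X -> k <= length X.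
Proof.
  intros Hk; enough (H : forall j, j <= k -> exists E, (forall a b, In (a, b) E -> adj a b) /\
    forall X, separates (adj_of E) A B X -> j <= length X) by (apply H; lia).
  induction j as [|j IH]; intros Hj.
  - exists []; split; [simpl; tauto|lia].
  - destruct IH as (E & HE & HX); [lia|].
    destruct (menger_finite E A B j HX) as (P & HP1 & HP2).
    destruct (lists_over_finite (flat_map P (seq 0 j)) j) as [LL HLL].
    (* [LL] may also contain longer lists, which might separate in [adj]; the filter removes
       them. *)
    destruct (finite_edges_nonseparated adj A B (filter (fun X => length X <=? j) LL))
      as (E' & HE' & Hns).
    { intros X HX' Hs; apply filter_In in HX' as [_ HX']; apply Nat.leb_le in HX'.
      apply Hk in Hs; lia. }
    exists (E ++ E'); split.
    { intros a b Hab; apply in_app_or in Hab; destruct Hab; auto. }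
    intros Y HY.
    assert (HYE : separates (adj_of E) A B Y).
    { eapply separates_mono; [|exact HY]. unfold adj_of; intros; rewrite !in_app_iff; tauto. }
    destruct (le_lt_dec (S j) (length Y)) as [|Hlt]; auto; exfalso.
    assert (Hlen : length Y = j) by (apply HX in HYE; lia).
    apply (Hns Y).
    2: { eapply separates_mono; [|exact HY].
         unfold adj_of; intros; rewrite !in_app_iff; tauto. }
    apply filter_In; split; [|apply Nat.leb_le; lia].
    apply HLL; auto.
    destruct Y as [|d Y']; [intros z []|]; set (Y := d :: Y') in *.
    destruct (choice_below (fun i z => In z (P i) /\ In z Y) d j) as [f Hf].
    { intros i Hi; destruct (HP1 i Hi) as (u & v & Hu & Hv & Hw). apply (HYE u (P i) v); auto. }
    destruct (distinct_values_exhaust f j Y) as [_ Hs]; try lia.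
    { intros i i' Hi Hi' Heq; apply NNPP; intros Hne.
      apply (HP2 i i' Hi Hi' Hne (f i)); [apply Hf; auto|rewrite Heq; apply Hf; auto]. }
    { intros i Hi; apply Hf; auto. }
    intros z Hz; destruct (Hs z Hz) as (i & Hi & <-).
    apply in_flat_map; exists i; split; [apply in_seq; lia|apply Hf; auto].
Qed.

Theorem menger {V} (adj : V -> V -> Prop) (A B : V -> Prop) k :
  (forall u w, adj u w -> adj w u) ->
  (forall X, separates adj A B X -> k <= length X) -> linked adj A B k.
Proof.
  intros Hsym H.
  destruct (finite_edges_same_connectivity adj A B k H) as (E & HE & HX).
  apply linked_mono with (adj_of E).
  - intros a b [Hab|Hab]; auto.
  - now apply menger_finite.
Qed.

(** * Fans *)

(* The fan [(c, Q)] has centre [c] and, for [i < k], a path [Q i] from the [i]-th entry of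
   [l] to [c]; [d] is only a default value for [nth]. *)
Definition is_fan {V} (adj : V -> V -> Prop) (k : nat) (d : V) (l : list V)
    (f : V * (nat -> list V)) : Prop :=
  ~ In (fst f) l /\
  (forall i, i < k -> path adj (nth i l d) (snd f i) (fst f)) /\
  (forall i w, i < k -> In w (snd f i) -> In w l -> w = nth i l d) /\
  (forall i j w, i < k -> j < k -> i <> j -> In w (snd f i) -> In w (snd f j) -> w = fst f).

(** Vertices of [l] are left out, since fans over the same [l] share their ends. The centre is
    listed separately so that the body is nonempty for [k = 0] too. *)
Definition fan_body {V} (k : nat) (l : list V) (f : V * (nat -> list V)) (w : V) : Prop :=
  w = fst f \/ (exists i, i < k /\ In w (snd f i) /\ ~ In w l).

(** The restricted adjacency encodes deletion of the vertex [x] on the same vertex type. *)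
Lemma walk_avoiding {V} (adj : V -> V -> Prop) x u p v :
  walk adj u p v -> ~ In x p -> walk (fun a b => adj a b /\ a <> x /\ b <> x) u p v.
Proof.
  induction 1 as [u|u w l v Huw Hw IH]; simpl; intros Hx; [constructor|].
  apply walk_cons with w; [|tauto].
  split; [|split]; auto. intros ->; apply Hx; right; eapply walk_source; eauto.
Qed.

(** The hypothesis [u <> x] excludes the one-vertex walk at [x], which uses no edge. *)
Lemma walk_avoids {V} (adj : V -> V -> Prop) x u p v :
  walk (fun a b => adj a b /\ a <> x /\ b <> x) u p v -> u <> x -> ~ In x p.
Proof.
  induction 1 as [u|u w l v (_ & _ & Hwx) Hw IH]; simpl; intros Hux [H|H]; auto.
  now apply IH.
Qed.

(** Some [u] in [L] escapes a shorter [X]. A path from [v] to [u] that avoids [X] except perhaps at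
    [v] becomes, without its first vertex, a walk from a neighbour of [v] to [U]. *)
Lemma k_connected_neighbours {V} (adj : V -> V -> Prop) k (U : V -> Prop) L v :
  k_connected adj k -> NoDup L -> length L = k -> (forall z, In z L -> U z) -> ~ U v ->
  forall X, separates (fun a b => adj a b /\ a <> v /\ b <> v) (adj v) U X -> k <= length X.
Proof.
  intros [_ Hk] HL Hlen HLU Hv X HX.
  destruct (le_lt_dec k (length X)) as [|Hlt]; auto; exfalso.
  assert (Hu : exists u, In u L /\ ~ In u X).
  { apply NNPP; intros Hc.
    assert (Hi : incl L X).
    { intros z Hz; apply NNPP; intros Hzx; apply Hc; eauto. }
    apply NoDup_incl_length in Hi; auto; lia. }
  destruct Hu as (u & HuL & HuX).
  assert (Huv : u <> v) by (intros ->; auto).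
  (* [v] is taken out because connectedness only concerns ends outside the deleted set;
     [boolp.pselect] decides equality of vertices. *)
  set (X' := remove (fun a b => boolp.pselect (a = b)) v X).
  destruct (Hk X') with (u := v) (v := u) as (p & [Hp Hnd] & HpX).
  - eapply Nat.le_lt_trans; [apply remove_length_le|auto].
  - apply remove_In.
  - intros HuX'; apply in_remove in HuX'; tauto.
  - inversion Hp as [|? w l ? Hvw Hw]; subst; [congruence|].
    inversion Hnd as [|? ? Hvl _]; subst.
    destruct (HX w l u Hvw) as (z & Hz & HzX); auto.
    + now apply walk_avoiding.
    + apply (HpX z); [simpl; auto|].
      apply in_in_remove; auto. intros ->; auto.
Qed.

(** Menger's theorem without [v], between its neighbours and [U], gives [k] disjoint walks. Cut at
    [U], extended by [v], reversed and shortened to paths, they form the fan. *)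
Lemma fan_exists {V} (adj : V -> V -> Prop) k d (U : V -> Prop) L v :
  simple_graph adj -> k_connected adj k -> NoDup L -> length L = k ->
  (forall z, In z L -> U z) -> ~ U v ->
  exists l Q, NoDup l /\ length l = k /\ (forall z, In z l -> U z) /\
    is_fan adj k d l (v, Q) /\
    (forall i w, i < k -> In w (Q i) -> U w -> In w l).
Proof.
  intros [Hsym Hirr] Hk HL Hlen HLU Hv.
  pose proof (k_connected_neighbours adj k U L v Hk HL Hlen HLU Hv) as Hsep.
  assert (Hlink : linked (fun a b => adj a b /\ a <> v /\ b <> v) (adj v) U k)
    by (apply menger; auto; intros u w (? & ? & ?); auto).
  destruct (linked_first_hit _ _ _ _ d Hlink) as (f & Hf & Hfd).
  set (l := map (fun i => snd (f i)) (seq 0 k)).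
  assert (Hl : forall z, In z l -> exists i, i < k /\ z = snd (f i)).
  { intros z Hz; apply in_map_iff in Hz as (i & <- & Hi); apply in_seq in Hi.
    exists i; split; auto; lia. }
  assert (Hnth : forall i, i < k -> nth i l d = snd (f i)).
  { intros i Hi; unfold l. rewrite nth_indep with (d' := snd (f 0)).
    - rewrite (map_nth (fun i => snd (f i))), seq_nth; auto.
    - now rewrite length_map, length_seq. }
  assert (Hfv : forall i, i < k -> ~ In v (fst (f i) ++ [snd (f i)])).
  { intros i Hi Hin; destruct (Hf i Hi) as (Hb & (u & Hu & Hw) & _).
    revert Hin; apply (walk_avoids _ _ _ _ _ Hw). intros ->; now apply (Hirr v). }
  destruct (choice_below (fun i q => path adj (snd (f i)) q v /\
      incl q (v :: fst (f i) ++ [snd (f i)])) [] k) as [Q HQ].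
  { intros i Hi; destruct (Hf i Hi) as (_ & (u & Hu & Hw) & _).
    assert (Hw' : walk adj v (v :: fst (f i) ++ [snd (f i)]) (snd (f i))).
    { apply walk_cons with u; auto. eapply walk_mono; [|eauto]. simpl; tauto. }
    apply walk_rev in Hw'; auto.
    destruct (walk_to_path _ _ _ _ Hw') as (q & Hq & Hi').
    exists q; split; auto. intros z Hz; apply in_rev; auto. }
  assert (HQU : forall i w, i < k -> In w (Q i) -> U w -> w = snd (f i)).
  { intros i w Hi Hw HU; apply (HQ i Hi) in Hw; destruct Hw as [<-|Hw]; [tauto|].
    apply in_app_or in Hw; destruct Hw as [Hw|[<-|[]]]; auto.
    exfalso; now apply (Hf i Hi) in Hw. }
  assert (HlU : forall z, In z l -> U z).
  { intros z Hz; destruct (Hl z Hz) as (i & Hi & ->); apply (Hf i Hi). }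
  exists l, Q; split; [|split; [|split; [|split]]]; auto.
  - apply NoDup_map_seq; intros i j Hi Hj Heq.
    apply (Hfd i j (snd (f i)) Hi Hj); [|rewrite Heq]; apply in_or_app; simpl; auto.
  - unfold l; now rewrite length_map, length_seq.
  - split; [|split; [|split]]; simpl.
    + intros Hin; auto.
    + intros i Hi; rewrite Hnth; auto. apply (HQ i Hi).
    + intros i w Hi Hw Hwl; rewrite Hnth; auto.
    + intros i j w Hi Hj Hne Hwi Hwj.
      apply (HQ i Hi) in Hwi; apply (HQ j Hj) in Hwj.
      destruct Hwi as [<-|Hwi]; auto. destruct Hwj as [<-|Hwj]; auto.
      exfalso; apply Hne, (Hfd i j w); auto.
  - intros i w Hi Hw HU; rewrite (HQU i w); auto.
    apply in_map_iff; exists i; split; auto. apply in_seq; lia.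
Qed.

(** * Maximal families of disjoint fans *)

Definition disjoint_fans {V} (adj : V -> V -> Prop) k d l (F : V * (nat -> list V) -> Prop) :=
  (forall f, F f -> is_fan adj k d l f) /\
  (forall f g, F f -> F g -> f <> g -> forall w, fan_body k l f w -> ~ fan_body k l g w).

(** Zorn's lemma applies since two fans from the union of a chain already lie in one member of the
    chain. *)
Lemma maximal_disjoint_fans {V} (adj : V -> V -> Prop) k d l :
  exists F, disjoint_fans adj k d l F /\
    forall f, is_fan adj k d l f ->
      (forall g, F g -> forall w, fan_body k l f w -> ~ fan_body k l g w) -> F f.
Proof.
  destruct (classical_sets.Zorn_bigcup (P := disjoint_fans adj k d l)) as (F & HF & Hmax).
  - intros C HC Htot; split.
    + intros f [F HF Hf]; exact (proj1 (HC F HF) f Hf).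
    + intros f g [F HF Hf] [G HG Hg].
      destruct (Htot F G HF HG) as [H|H].
      * apply (proj2 (HC G HG)); auto.
      * apply (proj2 (HC F HF)); auto.
  - exists F; split; auto.
    intros f Hf Hd; apply NNPP; intros HnF.
    apply (Hmax (fun g => F g \/ g = f)).
    + split; [intros g Hg; left; auto|]. intros Hc; apply HnF, Hc; right; auto.
    + split.
      * intros g [Hg| ->]; auto. apply (proj1 HF); auto.
      * intros g h [Hg| ->] [Hh| ->] Hne w Hw1 Hw2.
        -- exact (proj2 HF g h Hg Hh Hne w Hw1 Hw2).
        -- apply (Hd g Hg w); auto.
        -- apply (Hd h Hh w); auto.
        -- auto.
Qed.

(** The branch vertices are the entries of [l] and the centres. A common vertex outside [l] forces
    two paths into the same fan, where they meet only in the centre. *)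
Lemma subdivision_of_fans {V K : Type} (adj : V -> V -> Prop) k d l
    (F : V * (nat -> list V) -> Prop) (f : K -> V * (nat -> list V)) :
  NoDup l -> length l = k -> disjoint_fans adj k d l F ->
  (forall x, F (f x)) -> (forall x y, f x = f y -> x = y) ->
  @contains_subdivision_Kk V K adj k.
Proof.
  intros Hnd Hlen [HF Hdis] HfF Hinj.
  assert (Hfan : forall x, is_fan adj k d l (f x)) by auto.
  assert (Hd : forall x y w, fan_body k l (f x) w -> fan_body k l (f y) w -> x = y).
  { intros x y w Hx Hy; apply NNPP; intros Hne.
    apply (Hdis (f x) (f y)) with w; auto. }
  assert (Hl : forall i, i < k -> In (nth i l d) l) by (intros; apply nth_In; lia).
  assert (Hnl : forall i x w, i < k -> In w (snd (f x) i) -> w <> nth i l d ->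
    ~ In w l /\ fan_body k l (f x) w).
  { intros i x w Hi Hw Hne.
    assert (~ In w l) by (intros Hwl; apply Hne; now apply (Hfan x)).
    split; auto; right; exists i; auto. }
  exists (fun i => nth i l d), (fun x => fst (f x)), (fun i x => snd (f x) i).
  repeat split.
  - intros i j Hi Hj Heq. apply (proj1 (NoDup_nth l d) Hnd); auto; lia.
  - intros x y Heq. apply (Hd x y (fst (f x))); left; auto.
  - intros i x Hi Heq. apply (proj1 (Hfan x)). rewrite <- Heq; auto.
  - apply (Hfan x); auto.
  - apply (Hfan x); auto.
  - intros j Hj Heq. destruct (Hnl i x w) as [Hw _]; auto. apply Hw; rewrite Heq; auto.
  - intros y Heq. destruct (Hnl i x w) as [_ Hw]; auto.
    assert (x = y) by (apply (Hd x y w); auto; left; auto). congruence.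
  - intros i j x y w Hi Hj Hne Hwi Hwj.
    destruct (classic (In w l)) as [Hwl|Hwl].
    + left; exists i; split; auto. now apply (Hfan x).
    + right; exists x.
      assert (x = y).
      { apply (Hd x y w); right; [exists i|exists j]; auto. }
      subst y. destruct Hne as [Hne|Hne]; [|tauto].
      apply (Hfan x) with (i := i) (j := j); auto.
Qed.

(** * Small sets *)

(* Fewer than [K] elements, phrased so that no comparability of cardinals is needed. *)
Definition small (K : Type) {T} (S : T -> Prop) : Prop :=
  ~ exists f : K -> T, (forall x y, f x = f y -> x = y) /\ forall x, S (f x).

Lemma small_sub K {T} (S S' : T -> Prop) :
  (forall t, S t -> S' t) -> small K S' -> small K S.
Proof. intros H HS' (f & Hf & HfS); apply HS'; exists f; auto. Qed.

Lemma proj1_sig_inj {T} (S : T -> Prop) (a b : {t : T | S t}) :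
  proj1_sig a = proj1_sig b -> a = b.
Proof.
  destruct a as [a Ha], b as [b Hb]; simpl; intros ->.
  now rewrite (proof_irrelevance _ Ha Hb).
Qed.

Lemma small_not_le_card K {T} (S : T -> Prop) : small K S -> ~ le_card K {t : T | S t}.
Proof.
  intros HS [f Hf]; apply HS; exists (fun x => proj1_sig (f x)); split.
  - intros x y Heq; apply Hf, proj1_sig_inj, Heq.
  - intros x; apply proj2_sig.
Qed.

(** An injection of [K] into [S], followed by a choice of indices, would embed [K] in [nat]. With
    [option], [nth_error] of a list is an enumeration as well. *)
Lemma small_countable K {T} (S : T -> Prop) (g : nat -> option T) :
  uncountable K -> (forall t, S t -> exists n, g n = Some t) -> small K S.
Proof.
  intros HK Hg (f & Hf & HfS); apply HK.
  destruct (functional_choice (fun x n => g n = Some (f x))) as [h Hh]; auto.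
  exists h; intros x y Heq; apply Hf. pose proof (Hh x); pose proof (Hh y); congruence.
Qed.

Lemma small_finite K {T} (l : list T) : uncountable K -> small K (fun t => In t l).
Proof.
  intros HK; apply small_countable with (nth_error l); auto.
  intros t; apply In_nth_error.
Qed.

(* Regularity only speaks about unions over index types that embed into [K], which [J] need
   not do; the image of the choice function [j] does. *)
Lemma small_union K {J T} (I : J -> Prop) (S : J -> T -> Prop) :
  regular_card K -> small K I -> (forall i, I i -> small K (S i)) ->
  small K (fun t => exists i, I i /\ S i t).
Proof.
  intros Hreg HI HS (f & Hf & HfS).
  destruct (functional_choice (fun x i => I i /\ S i (f x))) as [j Hj]; auto.
  (* Regularity is applied to the fibres of [j], which cover [K]. Their index set, the image of [j],
     is small as a part of [I], and [f] embeds each fibre in some [S i]. *)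
  destruct (Hreg {i : J | exists x, i = j x} (fun i x => j x = proj1_sig i)) as [x Hx].
  - split.
    + destruct (functional_choice (fun (i : {i : J | exists x, i = j x}) x => proj1_sig i = j x))
        as [g Hg].
      { intros [i Hi]; auto. }
      exists g; intros a b Heq. apply proj1_sig_inj.
      rewrite (Hg a), (Hg b), Heq; auto.
    + apply small_not_le_card. eapply small_sub; [|exact HI].
      intros i [x ->]; apply Hj.
  - intros [i [x0 Hi]]; simpl; split.
    + exists (@proj1_sig _ _); apply proj1_sig_inj.
    + apply small_not_le_card. intros (g & Hg & Hgj).
      apply (HS i); [rewrite Hi; apply Hj|].
      exists (fun x => f (g x)); split.
      * intros x y Heq; apply Hg, Hf, Heq.
      * intros x; rewrite <- (Hgj x); apply Hj.
  - apply (Hx (exist _ (j x) (ex_intro _ x eq_refl))); reflexivity.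
Qed.

(** Lists of length [n + 1] form a union over heads [a] in [S] and tails [l'] of the singletons
    [[a :: l']]. *)
Lemma small_lists K {T} (S : T -> Prop) n :
  uncountable K -> regular_card K -> small K S ->
  small K (fun l => length l = n /\ forall z, In z l -> S z).
Proof.
  intros HK Hreg HS; induction n as [|n IH].
  - eapply small_sub; [|apply (small_finite K [[]] HK)].
    intros [|] [Hl _]; simpl; auto; discriminate.
  - eapply small_sub; [|apply (small_union K S (fun a l =>
      exists l', (length l' = n /\ forall z, In z l' -> S z) /\ In l [a :: l']) Hreg HS)].
    + intros [|a l] [Hl HlS]; [discriminate|].
      exists a; split; [apply HlS; simpl; auto|]. exists l; repeat split; simpl; auto.
      intros z Hz; apply HlS; simpl; auto.
    + intros a _; apply (small_union K _ (fun l' l => In l [a :: l'])); auto.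
      intros; now apply small_finite.
Qed.

Lemma small_fan_body K {V} k (l : list V) f :
  uncountable K -> regular_card K -> small K (fan_body k l f).
Proof.
  intros HK Hreg.
  eapply small_sub; [|apply (small_finite K (fst f :: flat_map (snd f) (seq 0 k)) HK)].
  intros w [->|(i & Hi & Hw & _)]; [simpl; auto|right].
  apply in_flat_map; exists i; split; auto. apply in_seq; lia.
Qed.

(** * Closing a set under maximal families of disjoint fans *)

(** The rounds are cumulative, so finitely many vertices of their union lie in a common round. *)
Fixpoint fan_closure {V} (k : nat) (F : list V -> V * (nat -> list V) -> Prop) (L : list V)
    (n : nat) (v : V) : Prop :=
  match n with
  | 0 => In v L
  | S n => fan_closure k F L n v \/
      exists l, ((length l = k /\ forall z, In z l -> fan_closure k F L n z) /\ NoDup l) /\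
        exists f, F l f /\ fan_body k l f v
  end.

Lemma fan_closure_le {V} k F (L : list V) m n v :
  m <= n -> fan_closure k F L m v -> fan_closure k F L n v.
Proof. induction 1; simpl; auto. Qed.

Lemma fan_closure_list {V} k F (L l : list V) :
  (forall z, In z l -> exists n, fan_closure k F L n z) ->
  exists n, forall z, In z l -> fan_closure k F L n z.
Proof.
  induction l as [|a l IH]; intros H.
  - exists 0; simpl; tauto.
  - destruct IH as [n Hn]; [intros; apply H; simpl; auto|].
    destruct (H a) as [m Hm]; [simpl; auto|].
    exists (Nat.max m n); intros z [<-|Hz].
    + apply fan_closure_le with m; auto; lia.
    + apply fan_closure_le with n; auto; lia.
Qed.

(** A round consists of the old vertices and the new ones, a union indexed by [bool]. The new ones
    form a threefold union: over [k]-lists, over fans of the family, over the body of a fan. *)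
Lemma small_fan_closure K {V} k F (L : list V) n :
  uncountable K -> regular_card K ->
  (forall l, NoDup l -> length l = k -> small K (F l)) -> small K (fan_closure k F L n).
Proof.
  intros HK Hreg HF; induction n as [|n IH]; simpl.
  - now apply small_finite.
  - eapply small_sub; [|apply (small_union K (fun _ : bool => True)
      (fun b v => if b then fan_closure k F L n v else
        exists l, ((length l = k /\ forall z, In z l -> fan_closure k F L n z) /\ NoDup l) /\
        exists f, F l f /\ fan_body k l f v) Hreg)].
    + intros v [Hv|Hv]; [exists true|exists false]; auto.
    + eapply small_sub; [|apply (small_finite K [true; false] HK)].
      intros [|]; simpl; auto.
    + intros [|] _; auto.
      apply (small_union K _ (fun l v => exists f, F l f /\ fan_body k l f v)); auto.
      * eapply small_sub; [|apply (small_lists K (fan_closure k F L n) k HK Hreg IH)]; tauto.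
      * intros l [[Hl _] Hnd].
        apply (small_union K _ (fun f v => fan_body k l f v)); auto.
        intros; now apply small_fan_body.
Qed.

(** * A large family of fans, or a vertex outside the closure *)

Theorem theorem2p1 (K : Type) (k : nat) (V : Type) (adj : V -> V -> Prop) :
  uncountable K -> regular_card K ->
  simple_graph adj -> k_connected adj k -> le_card K V ->
  @contains_subdivision_Kk V K adj k.
Proof.
  intros HK Hreg Hsimp Hconn [emb Hemb].
  (* Of the [k + 1] vertices, [d] becomes the default for [nth] and the other [k] form the starting
     set [L]. *)
  destruct (proj1 Hconn) as ([|d L] & HndL & HlenL); [discriminate|].
  destruct (functional_choice (fun l F => disjoint_fans adj k d l F /\
    forall f, is_fan adj k d l f ->
      (forall g, F g -> forall w, fan_body k l f w -> ~ fan_body k l g w) -> F f)) as [F HF].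
  { intros l; apply maximal_disjoint_fans. }
  destruct (classic (forall l, NoDup l -> length l = k -> small K (F l))) as [Hsm|Hns].
  - exfalso.
    assert (HU : small K (fun v => exists n, True /\ fan_closure k F L n v)).
    { apply small_union; auto.
      - apply small_countable with Some; eauto.
      - intros n _; now apply small_fan_closure. }
    assert (Hv : exists v, ~ exists n, fan_closure k F L n v).
    { apply NNPP; intros Hc; apply HU; exists emb; split; auto.
      intros x; apply NNPP; intros Hx; apply Hc; exists (emb x).
      intros [n Hn]; apply Hx; eauto. }
    destruct Hv as [v Hv].
    destruct (fan_exists adj k d (fun v => exists n, fan_closure k F L n v) L v)
      as (l & Q & Hnd & Hlen & HlU & Hfan & HQ); auto.
    { now inversion HndL. }
    { intros z Hz; exists 0; auto. }
    destruct (fan_closure_list k F L l HlU) as [n Hn].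
    (* All fans in [F l] have their bodies in round [n + 1], whereas the new fan meets the closure
       only in [l]. So maximality puts the new fan into [F l], and [v] into that round. *)
    assert (Hbody : forall g w, F l g -> fan_body k l g w -> fan_closure k F L (S n) w).
    { intros g w Hg Hw; right; exists l; repeat split; auto. exists g; auto. }
    apply Hv; exists (S n); apply (Hbody (v, Q)); [|left; auto].
    apply (proj2 (HF l)); auto.
    intros g Hg w Hw1 Hw2. apply (Hbody g w Hg) in Hw2.
    destruct Hw1 as [->|(i & Hi & Hw & Hwl)].
    + apply Hv; simpl; eauto.
    + apply Hwl, (HQ i w Hi Hw); eauto.
  (* Failure of [small] is an injection of [K] into the family [F l], which selects the fans of the
     subdivision. *)
  - apply not_all_ex_not in Hns as [l Hl].
    apply imply_to_and in Hl as [Hnd Hl]. apply imply_to_and in Hl as [Hlen Hl].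
    apply NNPP in Hl as (f & Hf & HfF).
    apply (subdivision_of_fans adj k d l (F l) f); auto. apply HF.
Qed.
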